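(* There exists a universal constant $L>0$ such that, for any $n$, $p$, $\Sigma$, $\sigma^2$, any non increasing sequence $(a_i)_{1\le i\le p+1}$ with $a_1=1$ and $a_{p+1}=0$, and any $R>0$, $$\inf_{\widehat\theta}\ \sup_{\theta\in\mathcal{E}_a(R)}\mathbb{E}_\theta\big[l(\widehat\theta,\theta)\big]\ \ge\ L\sup_{1\le i\le p}\Big[a_i^2R^2\wedge\frac{\sigma^2i}{n}\Big],$$ where the infimum is over all estimators $\widehat\theta$ of $\theta$ based on the $n$ observations.
   Context: Model: $Y=X\theta+\epsilon$, where $\theta\in\mathbb{R}^p$, the row vector $X=(X_i)_{1\le i\le p}$ is a zero mean Gaussian vector with nonsingular covariance matrix $\Sigma$, and $\epsilon$ is a zero mean Gaussian variable with variance $\sigma^2>0$, independent of $X$. One observes $n$ i.i.d. replications of $(Y,X)$; $\mathbb{E}_\theta$ is the corresponding expectation. The loss is $l(\theta_1,\theta_2):=\mathbb{E}[(X\theta_1-X\theta_2)^2]$. For $0\le i\le p$ let $m_0=\emptyset$, $m_i=\{1,\dots,i\}$, and let $\theta_{m_i}$ be the unique minimizer of $\theta'\mapsto\mathbb{E}_\theta[(Y-X\theta')^2]$ over the vectors $\theta'\in\mathbb{R}^p$ whose components outside $m_i$ vanish. The ellipsoid is $\mathcal{E}_a(R):=\big\{\theta\in\mathbb{R}^p:\ \sum_{i=1}^p\frac{l(\theta_{m_{i-1}},\theta_{m_i})}{a_i^2}\le R^2\big\}$ (with $0/0=0$ and $x/0=+\infty$ for $x>0$). $\wedge$ denotes the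 minimum. *)

(* Defs.v *)
From HB Require Import structures.
From mathcomp Require Import all_boot all_order all_algebra.
From mathcomp Require Import all_classical all_reals all_analysis.
From mathcomp Require Import measurable_realfun.

Set Implicit Arguments.
Unset Strict Implicit.
Unset Printing Implicit Defensive.

Import Order.TTheory GRing.Theory Num.Theory.
Import numFieldNormedType.Exports.

Local Open Scope classical_set_scope.
Local Open Scope ring_scope.

Section product_law.
Context d (S : measurableType d) (R : realType) (Q : probability S R).

Definition cons_pair n (z : S * n.-tuple S) : n.+1.-tuple S :=
  [tuple of z.1 :: z.2].

Lemma measurable_cons_pair n :
  measurable_fun [set: S * n.-tuple S] (@cons_pair n).
Proof. exact: measurable_cons. Qed.

HB.instance Definition _ n :=
  isMeasurableFun.Build _ _ _ _ (@cons_pair n) (@measurable_cons_pair n).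

(* The law of n independent variables of law Q, i.e. the n-fold product
   measure; see iid_law_box. *)
Fixpoint iid_law n : probability (n.-tuple S) R :=
  if n is n'.+1 then distribution (Q \x iid_law n')%E (@cons_pair n')
  else \d_[tuple].

End product_law.

Lemma measurable_box d (S : measurableType d) n (A : 'I_n -> set S) :
  (forall k, measurable (A k)) ->
  measurable [set z : n.-tuple S | forall k, A k (tnth z k)].
Proof.
move=> mA.
rewrite (_ : [set z | _] = \big[setI/setT]_(k < n) (@tnth n S ^~ k @^-1` A k)).
  by apply: bigsetI_measurable => k _; rewrite -[X in measurable X]setTI; apply: measurable_tnth.
apply/seteqP; split => z /=.
  by move=> Az; rewrite -bigcap_seq /= => k _ ; exact: Az.
by rewrite -bigcap_seq => h k; apply: (h k); rewrite /= mem_index_enum.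
Qed.

Lemma iid_law_box d (S : measurableType d) (R : realType)
    (Q : probability S R) n (A : 'I_n -> set S) :
  (forall k, measurable (A k)) ->
  iid_law Q n [set z | forall k, A k (tnth z k)] = (\prod_(k < n) Q (A k))%E.
Proof.
elim: n A => [|n IH] A mA.
  by rewrite big_ord0 /= diracE mem_set//= => -[].
rewrite big_ord_recl /= /distribution /pushforward.
set B := (X in product_measure1 _ _ X).
have -> : B = A ord0 `*` [set z : n.-tuple S | forall k, A (lift ord0 k) (tnth z k)].
  apply/seteqP; split => -[x z] /=.
    move=> h; split; first exact: (h ord0).
    by move=> k; have := h (lift ord0 k); rewrite /= tnthS.
  case=> h0 h k; case: (unliftP ord0 k) => [j ->|->//].
  by rewrite /= tnthS; exact: h.
rewrite product_measure1E//; last by apply: (@measurable_box _ _ _ (fun k => A (lift ord0 k))).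
by congr (_ * _)%E; exact: (IH (fun k => A (lift ord0 k))).
Qed.

Section gaussian.
Context d (T : measurableType d) (R : realType) (P : probability T R).

(* normal_prob m s is only N(m, s ^+ 2) for s != 0 (it is a uniform law for
   s = 0), hence the separate treatment of constants. *)
Definition gaussian_rv (f : T -> R) : Prop :=
  exists m : R,
    (forall A : set R, measurable A -> P (f @^-1` A) = \d_m A) \/
    (exists2 s : R, 0 < s &
      forall A : set R, measurable A -> P (f @^-1` A) = normal_prob m s A).

Definition dot p (x t : p.-tuple R) : R := \sum_(j < p) tnth x j * tnth t j.

Definition gaussian_vector p (X : T -> p.-tuple R) : Prop :=
  forall u : p.-tuple R, gaussian_rv (fun w => dot (X w) u).

Definition has_zero_mean p (X : T -> p.-tuple R) : Prop :=
  forall i : 'I_p, ('E_P[fun w => tnth (X w) i] = 0)%E.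

Definition has_covariance p (X : T -> p.-tuple R) (Sigma : 'M[R]_p) : Prop :=
  forall i j : 'I_p,
    covariance P (fun w => tnth (X w) i) (fun w => tnth (X w) j)
    = (Sigma i j)%:E.

Definition independent_rv d1 d2 (T1 : measurableType d1)
    (T2 : measurableType d2) (f : T -> T1) (g : T -> T2) : Prop :=
  forall (A : set T1) (B : set T2), measurable A -> measurable B ->
    P (f @^-1` A `&` g @^-1` B) = (P (f @^-1` A) * P (g @^-1` B))%E.

End gaussian.

Section regression.
Context d (T : measurableType d) (R : realType) (P : probability T R).
Context (p : nat) (X : {RV P >-> p.-tuple R}) (eps : {RV P >-> R}).

Implicit Types t : p.-tuple R.

Definition response t : T -> R := fun w => dot (X w) t + eps w.

Definition loss t1 t2 : \bar R :=
  'E_P[fun w => ((dot (X w) t1 - dot (X w) t2) ^+ 2)%R]%E.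

Definition observation t : T -> R * p.-tuple R := fun w => (response t w, X w).

Lemma measurable_observation t : measurable_fun [set: T] (observation t).
Proof.
apply: measurable_fun_pair => //=.
apply: measurable_funD => //.
apply: measurable_sum => j.
apply: measurable_funM => //.
exact: (measurableT_comp (measurable_tnth j)).
Qed.

HB.instance Definition _ t :=
  isMeasurableFun.Build _ _ _ _ (observation t) (@measurable_observation t).

Definition sample_law n t : probability (n.-tuple (R * p.-tuple R)%type) R :=
  iid_law (distribution P (observation t)) n.

(* t has no component outside m_i = {1, ..., i}; components are numbered from
   0 in p.-tuple R. *)
Definition in_model (i : nat) t : Prop :=
  forall j : 'I_p, (i <= j)%N -> tnth t j = 0.

Definition prediction_error t t' : \bar R :=
  'E_P[fun w => ((response t w - dot (X w) t') ^+ 2)%R]%E.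

Definition best_approximations (i : nat) t : set (p.-tuple R) :=
  [set u | in_model i u /\
    forall v, in_model i v -> (prediction_error t u <= prediction_error t v)%E].

(* The unique minimizer theta_(m_i); the default value is never used when the
   covariance matrix of X is nonsingular. *)
Definition best_approximation (i : nat) t : p.-tuple R :=
  xget [tuple of nseq p 0] (best_approximations i t).

(* In \bar R, 0^-1 = +oo and 0 * +oo = 0, so that 0 / 0 = 0 and x / 0 = +oo
   for x > 0. *)
Definition ellipsoid (a : nat -> R) (r : R) : set (p.-tuple R) :=
  [set t | (\sum_(1 <= i < p.+1)
       loss (best_approximation i.-1 t) (best_approximation i t)
         / ((a i) ^+ 2)%:E <= (r ^+ 2)%:E)%E].

Definition risk n
    (that : {mfun n.-tuple (R * p.-tuple R)%type >-> p.-tuple R}) t : \bar R :=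
  (\int[sample_law n t]_z loss (that z) t)%E.

Definition minimax_risk n (E : set (p.-tuple R)) : \bar R :=
  ereal_inf [set ereal_sup [set risk that t | t in E] |
    that in [set: {mfun n.-tuple (R * p.-tuple R)%type >-> p.-tuple R}]].

End regression.

(* Main.v *)
(* On a hypercube inside the ellipsoid, Assouad's argument reduces the bound to
   two-point problems.  Writing Sigma = M M^T with M lower triangular, the
   coordinates v = theta M turn the loss into the squared Euclidean distance
   and theta_(m_i) into the truncation of v to its first i entries, so the
   ellipsoid becomes sum v_i^2 / a_i^2 <= R^2 and contains all v with entries
   +-s on the first i coordinates as soon as i s^2 <= a_i^2 R^2.  Flipping one
   sign moves theta by a loss 4 s^2; since exp (- q) >= 1 - q, the Hellinger
   affinity of the laws of one observation is at least 1 - s^2 / (2 sigma^2),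
   hence at least 3/4 for n observations if s^2 <= sigma^2 / (2 n), and each
   coordinate costs at least s^2 / 2 on average over the cube. *)
Require Import Defs.
From HB Require Import structures.
From mathcomp Require Import all_boot all_order all_algebra.
From mathcomp Require Import all_classical all_reals all_analysis.
From mathcomp Require Import measurable_realfun ring lra.

Set Implicit Arguments.
Unset Strict Implicit.
Unset Printing Implicit Defensive.

Import Order.TTheory GRing.Theory Num.Theory.
Import numFieldNormedType.Exports.

Local Open Scope classical_set_scope.
Local Open Scope ring_scope.

(** * Translations and densities of normal laws *)

Section normal_translation.
Context {R : realType}.
Implicit Types (m s : R) (A : set R).
Local Notation mu := (@lebesgue_measure R).

(** The image measure has the right value on half-open intervals, and these determine Lebesgue
    measure. *)
Lemma lebesgue_measure_shift m A : measurable A ->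
  pushforward mu (shift m : _ -> measurableTypeR R) A = mu A.
Proof.
move=> mA; apply/esym.
have ms : measurable_fun [set: R] (shift m : _ -> measurableTypeR R).
  exact: measurable_funD.
pose h := isMeasurableFun.Build _ _ _ _ _ ms.
pose phi : {mfun _ >-> _} := HB.pack (shift m : R -> measurableTypeR R) h.
apply: (@lebesgue_measure_unique _ (pushforward mu phi)) => //= _ [[a b]] _ <-.
rewrite /pushforward /=.
have -> : (phi @^-1` `]a, b] : set R) = `]a - m, b - m]%classic.
  by apply/seteqP; split => x /=; rewrite !in_itv/= /shift/= ltrBlDr lerBrDr.
rewrite !lebesgue_measure_itv/= !lte_fin ltrD2r -!EFinB.
by congr (if _ then _%:E else _); ring.
Qed.

Lemma normal_prob_shift m s A : s != 0 -> measurable A ->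
  normal_prob m s A = normal_prob 0 s (shift m @^-1` A).
Proof.
move=> s0 mA; rewrite /normal_prob.
transitivity (\int[pushforward mu (shift m : R -> measurableTypeR R)]_(x in A)
    (normal_pdf m s x)%:E)%E.
  apply: eq_measure_integral => /=; first exact: measurable_funD.
  by move=> _ B mB _; exact/esym/lebesgue_measure_shift.
rewrite ge0_integral_pushforward//=; last 3 first.
- exact: measurable_funD.
- apply/measurable_EFinP; apply: measurable_funTS.
  exact: measurable_normal_pdf.
- by move=> x _; rewrite lee_fin normal_pdf_ge0.
apply: eq_integral => x _ /=; congr EFin.
by rewrite !normal_pdfE// normal_fun_center /= addrK.
Qed.

(** Used given [X = x]: the noise shifted by the regression value becomes a normal law with that
    mean. *)
Lemma ge0_integral_normal_shift m s (f : measurableTypeR R -> \bar R) :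
  s != 0 -> measurable_fun [set: measurableTypeR R] f ->
  (forall x, 0 <= f x)%E ->
  (\int[normal_prob 0 s]_e f (m + e)%R = \int[normal_prob m s]_y f y)%E.
Proof.
move=> s0 mf f0.
have ms : measurable_fun [set: measurableTypeR R]
    (shift m : _ -> measurableTypeR R) by exact: measurable_funD.
transitivity (\int[pushforward (normal_prob 0 s)
    (shift m : _ -> measurableTypeR R)]_y f y)%E.
  rewrite ge0_integral_pushforward//=.
  by apply: eq_integral => e _; rewrite addrC.
by apply: eq_measure_integral => //= B mB _; exact/esym/normal_prob_shift.
Qed.

(** The Radon-Nikodym derivative and [normal_pdf] have the same integral over every measurable set,
    so they agree almost everywhere. *)
Lemma ge0_integral_normal_prob m s (f : measurableTypeR R -> \bar R) :
  measurable_fun [set: measurableTypeR R] f -> (forall x, 0 <= f x)%E ->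
  (\int[normal_prob m s]_y f y = \int[mu]_y (f y * (normal_pdf m s y)%:E))%E.
Proof.
move=> mf f0; have dom := @normal_prob_dominates R m s.
rewrite -(Radon_Nikodym_SigmaFinite.change_of_variables
  (nu := normal_prob m s) (mu := mu))//.
have intRN := Radon_Nikodym_SigmaFinite.f_integrable dom.
apply: ge0_ae_eq_integral => //.
- by apply: emeasurable_funM => //; exact: measurable_int intRN.
- apply: emeasurable_funM => //; apply/measurable_EFinP.
  exact: measurable_normal_pdf.
- by move=> x _; rewrite mule_ge0//; exact: Radon_Nikodym_SigmaFinite.f_ge0.
- by move=> x _; rewrite mule_ge0// lee_fin normal_pdf_ge0.
- apply: ae_eqe_mul2l; apply: integral_ae_eq => //.
    by apply/measurable_EFinP; exact: measurable_normal_pdf.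
  move=> A _ mA; rewrite -Radon_Nikodym_SigmaFinite.f_integral//.
Qed.

End normal_translation.

(** * Hellinger affinity in dual form and its tensorization *)

Section affinity.
Local Open Scope ereal_scope.

(* Dual form of [rho <= \int sqrt (dP dQ)]: it needs no density and passes to
   products by Fubini-Tonelli alone. *)
Definition affinity_ge d (S : measurableType d) (R : realType)
    (P Q : {measure set S -> \bar R}) (rho : R) : Prop :=
  forall f g : S -> \bar R,
    measurable_fun [set: S] f -> measurable_fun [set: S] g ->
    (forall x, 0 <= f x) -> (forall x, 0 <= g x) ->
    forall k : R, (0 <= k)%R ->
    (forall x (l : R), (0 < l)%R -> k%:E <= l%:E * f x + l^-1%:E * g x) ->
    forall l : R, (0 < l)%R ->
    (rho * k)%:E <= l%:E * (\int[P]_x f x) + l^-1%:E * (\int[Q]_x g x).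

Lemma ge0_integral_iid_lawS d (S : measurableType d) (R : realType)
    (P : probability S R) n (f : n.+1.-tuple S -> \bar R) :
  measurable_fun setT f -> (forall z, 0 <= f z) ->
  \int[iid_law P n.+1]_z f z
  = \int[P]_x \int[iid_law P n]_z f (cons_pair (x, z)).
Proof.
move=> mf f0; rewrite /= ge0_integral_distribution//.
by rewrite fubini_tonelli1//=; exact: measurableT_comp.
Qed.

(** Induction on [n]: with the first observation fixed, the integrals over the other ones satisfy
    the premise of [affinity_ge P Q] with [rho ^+ n * k] in place of [k]. This works because the
    premise and the conclusion both range over all weights [l]. *)
Lemma affinity_ge_iid d (S : measurableType d) (R : realType)
    (P Q : probability S R) (rho : R) n : (0 <= rho)%R ->
  affinity_ge P Q rho -> affinity_ge (iid_law P n) (iid_law Q n) (rho ^+ n).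
Proof.
move=> rho0 PQ; elim: n => [|n IH] f g mf mg f0 g0 k k0 fg l l0.
  by rewrite /= expr0 mul1r !integral_dirac//= !diracT !mul1e; exact: fg.
have mfc (h : n.+1.-tuple S -> \bar R) : measurable_fun setT h ->
    measurable_fun [set: S * n.-tuple S] (fun z => h (cons_pair z)).
  by move=> mh; exact: measurableT_comp.
rewrite !ge0_integral_iid_lawS// exprS -mulrA.
apply: PQ => //.
- exact: (measurable_fun_fubini_tonelli_F (m2 := iid_law P n)
    (fun z => f (cons_pair z)) (mfc _ mf)).
- exact: (measurable_fun_fubini_tonelli_F (m2 := iid_law Q n)
    (fun z => g (cons_pair z)) (mfc _ mg)).
- by move=> x; exact: integral_ge0.
- by move=> x; exact: integral_ge0.
- by rewrite mulr_ge0// exprn_ge0.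
- move=> x l' l'0; apply: IH => //.
  + by apply: measurableT_comp => //; exact/measurableT_comp.
  + by apply: measurableT_comp => //; exact/measurableT_comp.
  + by move=> z l'' l''0; exact: fg.
Qed.

End affinity.

(** * Affinity of two normal laws of equal variance *)

Section normal_affinity.
Context {R : realType}.
Local Notation mu := (@lebesgue_measure R).

(** Completing the square: the geometric mean of the two densities is the density centred at the
    midpoint, times their Hellinger affinity. *)
Lemma normal_pdf_mul (m1 m2 s y : R) : 0 < s ->
  normal_pdf m1 s y * normal_pdf m2 s y =
  (expR (- (m1 - m2) ^+ 2 / (8 * s ^+ 2)) *
   normal_pdf ((m1 + m2) / 2) s y) ^+ 2.
Proof.
move=> s0; rewrite !normal_pdfE ?gt_eqF// /normal_fun.
rewrite mulrACA -expRD [in RHS]mulrCA -expRD exprMn expr2; congr (_ * _).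
rewrite -expRM_natl mulr2n; congr expR; field.
by rewrite -mulr2n mulrn_eq0/= sqrf_eq0 gt_eqF.
Qed.

Lemma normal_pdf_gt0 (m s y : R) : 0 < s -> 0 < normal_pdf m s y.
Proof.
move=> s0; rewrite normal_pdfE ?gt_eqF//.
by rewrite mulr_gt0 ?normal_peak_gt0 ?gt_eqF// expR_gt0.
Qed.

(** The geometric mean [w] of the two densities has total mass [rho], so [rho * k] is the Lebesgue
    integral of [k * w] and it suffices to compare integrands pointwise. *)
Lemma affinity_ge_normal (m1 m2 s : R) : 0 < s ->
  affinity_ge (normal_prob m1 s) (normal_prob m2 s)
    (expR (- (m1 - m2) ^+ 2 / (8 * s ^+ 2))).
Proof.
move=> s0 f g mf mg f0 g0 k k0 fg l l0.
set rho := expR _; set m := (m1 + m2) / 2.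
have mpdf m' : measurable_fun [set: measurableTypeR R]
    (fun y => (normal_pdf m' s y)%:E).
  by apply/measurable_EFinP; exact: measurable_normal_pdf.
have mM h m' : measurable_fun [set: measurableTypeR R] h ->
    measurable_fun [set: measurableTypeR R]
      (fun y => h y * (normal_pdf m' s y)%:E)%E.
  by move=> mh; exact: emeasurable_funM.
have ge0M (h : _ -> \bar R) m' y : (0 <= h y)%E ->
    (0 <= h y * (normal_pdf m' s y)%:E)%E.
  by move=> h0; rewrite mule_ge0// lee_fin normal_pdf_ge0.
have -> : (rho * k)%:E = (\int[mu]_y ((rho * k)%:E * (normal_pdf m s y)%:E))%E.
  rewrite ge0_integralZl_EFin//.
  - by rewrite integral_normal_pdf mule1.
  - by move=> y _; rewrite lee_fin normal_pdf_ge0.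
  - by rewrite mulr_ge0// expR_ge0.
rewrite !ge0_integral_normal_prob//.
have li0 : 0 <= l^-1 by rewrite invr_ge0 ltW.
rewrite -(ge0_integralZl_EFin _ _ _ _ (ltW l0))//; last 2 first.
- by move=> y _; exact: ge0M.
- exact: mM.
rewrite -(ge0_integralZl_EFin _ _ _ _ li0)//; last 2 first.
- by move=> y _; exact: ge0M.
- exact: mM.
rewrite -ge0_integralD//; last 4 first.
- by move=> y _; apply: mule_ge0; [rewrite lee_fin ltW|exact: ge0M].
- by apply: measurable_funeM; exact: mM.
- by move=> y _; apply: mule_ge0; [rewrite lee_fin|exact: ge0M].
- by apply: measurable_funeM; exact: mM.
have w0 y : 0 < rho * normal_pdf m s y.
  by rewrite mulr_gt0 ?expR_gt0// normal_pdf_gt0.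
apply: ge0_le_integral => //.
- by move=> y _; rewrite mule_ge0 ?lee_fin ?normal_pdf_ge0// mulr_ge0 ?expR_ge0.
- exact: measurable_funeM.
- by apply: emeasurable_funD; apply: measurable_funeM; exact: mM.
move=> y _; have := normal_pdf_mul m1 m2 y s0.
rewrite -/rho -/m; move: (w0 y).
rewrite -EFinM (mulrAC rho k); set w := rho * _ => {}w0 pq.
have p0 := normal_pdf_gt0 m1 y s0; have q0 := normal_pdf_gt0 m2 y s0.
(* The premise is used at a weight depending on [y]. Multiplied by [w], this weight becomes [l]
   times the first density, and its inverse becomes [l^-1] times the second one, since [w ^+ 2] is
   the product of the densities. *)
have l'0 : 0 < l * normal_pdf m1 s y / w by rewrite divr_gt0// mulr_gt0.
have := fg y _ l'0; rewrite -(@lee_pmul2l _ w%:E)// => /le_trans; apply.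
rewrite ge0_muleDr; last 2 first.
- by apply: mule_ge0; rewrite // lee_fin ltW.
- by apply: mule_ge0; rewrite // lee_fin invr_ge0 ltW.
rewrite !(muleC (f y)) !(muleC (g y)) !muleA -!EFinM.
apply: leeD; apply: lee_wpmul2r => //; rewrite lee_fin le_eqVlt.
all: apply/orP; left.
  by apply/eqP; field; rewrite gt_eqF.
apply/eqP; have -> : normal_pdf m2 s y = w ^+ 2 / normal_pdf m1 s y.
  by rewrite -pq mulrAC mulfV ?mul1r// gt_eqF.
by field; rewrite !gt_eqF.
Qed.

End normal_affinity.

(** * Affinity of the laws of one observation *)

Section regression.
Context d (T : measurableType d) (R : realType) (P : probability T R).
Context (p : nat) (X : {RV P >-> p.-tuple R}) (eps : {RV P >-> R}).
Context (sigma : R).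
Hypothesis sigma0 : 0 < sigma.
Hypothesis eps_normal : forall A : set R, measurable A ->
  distribution P eps A = normal_prob 0 sigma A.
Hypothesis X_eps : independent_rv P X eps.
Implicit Types t u : p.-tuple R.

Lemma measurable_dot t : measurable_fun [set: p.-tuple R] (fun x => dot x t).
Proof.
apply: measurable_sum => j; apply: measurable_funM => //.
exact: measurable_tnth.
Qed.

(** By independence the joint law agrees with the product measure on rectangles, hence everywhere;
    Tonelli then gives the iterated integral. *)
Lemma ge0_integral_joint (f : p.-tuple R * measurableTypeR R -> \bar R) :
  measurable_fun setT f -> (forall z, 0 <= f z)%E ->
  (\int[P]_w f (X w, eps w) =
   \int[distribution P X]_x \int[normal_prob 0 sigma]_e f (x, e))%E.
Proof.
move=> mf f0.
have mj : measurable_fun [set: T]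
    (fun w => (X w, eps w) : p.-tuple R * measurableTypeR R).
  by apply: measurable_fun_pair => //; exact: (@measurable_funPT _ _ _ _ eps).
pose h := isMeasurableFun.Build _ _ _ _ _ mj.
pose joint : {mfun T >-> (p.-tuple R * measurableTypeR R)%type} :=
  HB.pack (fun w => (X w, eps w) : p.-tuple R * measurableTypeR R) h.
rewrite -(@fubini_tonelli1 _ _ _ _ _ (distribution P X)
  (normal_prob 0 sigma : {measure set (measurableTypeR R) -> \bar R}) f mf f0).
rewrite (eq_measure_integral (pushforward P joint)); last first.
  move=> A mA _; apply: product_measure_unique => //= A1 A2 mA1 mA2.
  by rewrite /pushforward/= -eps_normal//; exact: X_eps.
by rewrite ge0_integral_pushforward.
Qed.

Lemma loss_distribution t u : loss X t u =
  (\int[distribution P X]_x (((dot x t - dot x u) ^+ 2)%R)%:E)%E.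
Proof.
rewrite ge0_integral_distribution//.
- by rewrite /loss unlock.
- apply/measurable_EFinP; apply: measurable_funX.
  by apply: measurable_funB; exact: measurable_dot.
- by move=> x; rewrite lee_fin sqr_ge0.
Qed.

Lemma measurable_shift_observation t (f : R * p.-tuple R -> \bar R) :
  measurable_fun setT f ->
  measurable_fun setT
    (fun z : p.-tuple R * measurableTypeR R => f (dot z.1 t + z.2, z.1)).
Proof.
move=> mf; apply: measurableT_comp => //; apply: measurable_fun_pair => //=.
apply: measurable_funD; last exact: measurable_snd.
exact: (measurableT_comp (measurable_dot t)).
Qed.

Lemma ge0_integral_observation t (f : R * p.-tuple R -> \bar R) :
  measurable_fun setT f -> (forall z, 0 <= f z)%E ->
  (\int[distribution P (observation X eps t)]_z f z =
   \int[distribution P X]_x \int[normal_prob 0 sigma]_e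
     f (dot x t + e, x)%R)%E.
Proof.
move=> mf f0; rewrite ge0_integral_distribution//.
by rewrite -(ge0_integral_joint (measurable_shift_observation t mf)).
Qed.

(* Conditionally on [X = x] the two laws are N(x.t, sigma^2) and
   N(x.u, sigma^2); then [exp (- q) >= 1 - q] is integrated over [x]. *)
Lemma affinity_ge_observation t u (l : R) : loss X t u = l%:E ->
  affinity_ge (distribution P (observation X eps t))
    (distribution P (observation X eps u)) (1 - l / (8 * sigma ^+ 2)).
Proof.
move=> tul f g mf mg f0 g0 k k0 fg r r0.
rewrite !ge0_integral_observation//.
pose Q := distribution P X.
pose F := fun x => (\int[normal_prob 0 sigma]_e f (dot x t + e, x)%R)%E.
pose G := fun x => (\int[normal_prob 0 sigma]_e g (dot x u + e, x)%R)%E.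
change (((1 - l / (8 * sigma ^+ 2)) * k)%:E <=
  r%:E * (\int[Q]_x F x) + r^-1%:E * (\int[Q]_x G x))%E.
pose q x : R := (dot x t - dot x u) ^+ 2 / (8 * sigma ^+ 2).
have q0 x : 0 <= q x by rewrite divr_ge0 ?sqr_ge0// mulr_ge0 ?sqr_ge0.
have mF : measurable_fun setT F.
  exact: (measurable_fun_fubini_tonelli_F (m2 := normal_prob 0 sigma) _
    (measurable_shift_observation t mf)).
have mG : measurable_fun setT G.
  exact: (measurable_fun_fubini_tonelli_F (m2 := normal_prob 0 sigma) _
    (measurable_shift_observation u mg)).
have F0 x : (0 <= F x)%E by exact: integral_ge0.
have G0 x : (0 <= G x)%E by exact: integral_ge0.
have FG x : ((k - q x * k)%:E <= r%:E * F x + r^-1%:E * G x)%E.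
  have mfx : measurable_fun [set: measurableTypeR R] (fun y => f (y, x)).
    by apply: measurableT_comp => //; exact: measurable_fun_pair.
  have mgx : measurable_fun [set: measurableTypeR R] (fun y => g (y, x)).
    by apply: measurableT_comp => //; exact: measurable_fun_pair.
  rewrite /F /G (@ge0_integral_normal_shift _ _ _ (fun y => f (y, x)))
    ?gt_eqF//.
  rewrite (@ge0_integral_normal_shift _ _ _ (fun y => g (y, x))) ?gt_eqF//.
  have fgx y r' : 0 < r' -> (k%:E <= r'%:E * f (y, x) + r'^-1%:E * g (y, x))%E.
    by move=> r'0; exact: fg.
  apply: le_trans (affinity_ge_normal (dot x t) (dot x u) sigma0 mfx mgx
    (fun=> f0 _) (fun=> g0 _) k0 fgx r0).
  rewrite lee_fin -[leLHS]/(k - q x * k) -{1}(mul1r k) -mulrBl ler_wpM2r//.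
  by rewrite mulNr; exact: expR_ge1Dx.
have mq : measurable_fun [set: p.-tuple R] q.
  apply: measurable_funM => //; apply: measurable_funX.
  by apply: measurable_funB; exact: measurable_dot.
have intq : (\int[Q]_x (q x * k)%:E = (l / (8 * sigma ^+ 2) * k)%:E)%E.
  under eq_integral do rewrite /q -mulrA mulrC EFinM.
  rewrite ge0_integralZl_EFin//.
  - rewrite -loss_distribution tul -EFinM; congr EFin; ring.
  - by move=> x _; rewrite lee_fin sqr_ge0.
  - apply/measurable_EFinP; apply: measurable_funX.
    by apply: measurable_funB; exact: measurable_dot.
  - by rewrite mulr_ge0// invr_ge0 mulr_ge0// sqr_ge0.
(* The term in [q] changes sides, so that only integrals of nonnegative functions are added. *)
rewrite mulrBl mul1r EFinB leeBlDr// -intq.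
rewrite -!ge0_integralZl_EFin ?invr_ge0 ?(ltW r0)//.
have mrF : measurable_fun setT (fun x => r%:E * F x)%E.
  exact: measurable_funeM.
have mrG : measurable_fun setT (fun x => r^-1%:E * G x)%E.
  exact: measurable_funeM.
have rF0 x : (0 <= r%:E * F x)%E by rewrite mule_ge0// lee_fin ltW.
have rG0 x : (0 <= r^-1%:E * G x)%E by rewrite mule_ge0// lee_fin invr_ge0 ltW.
have mqk : measurable_fun [set: p.-tuple R] (fun x => (q x * k)%:E).
  by apply/measurable_EFinP; exact: measurable_funM.
have qk0 x : (0 <= (q x * k)%:E)%E by rewrite lee_fin mulr_ge0.
rewrite -ge0_integralD// -ge0_integralD//; last 2 first.
- by move=> x _; exact: adde_ge0.
- exact: emeasurable_funD.
have -> : k%:E = (\int[Q]_x cst k%:E x)%E.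
  rewrite integral_cst// -[LHS]mule1; congr (_ * _)%E.
  exact/esym/probability_setT.
apply: ge0_le_integral => //.
- by apply: emeasurable_funD => //; exact: emeasurable_funD.
- by move=> x _; rewrite -leeBlDr//; exact: FG.
Qed.

End regression.

(** * Second moments of normal laws *)

Section normal_second_moment.
Context {R : realType}.
Local Notation mu := (@lebesgue_measure R).
Implicit Types (m s a : R) (A : set R).

Lemma normal_prob_opp s A : s != 0 -> measurable A ->
  normal_prob 0 s A = normal_prob 0 s (-%R @^-1` A).
Proof.
move=> s0 mA; rewrite /normal_prob.
transitivity (\int[pushforward mu (-%R : R -> measurableTypeR R)]_(x in A)
    (normal_pdf 0 s x)%:E)%E.
  apply: eq_measure_integral => B mB _; exact/esym/lebesgue_measureN.
rewrite ge0_integral_pushforward//=; last 2 first.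
- apply/measurable_EFinP; apply: measurable_funTS.
  exact: measurable_normal_pdf.
- by move=> x _; rewrite lee_fin normal_pdf_ge0.
apply: eq_integral => x _ /=; congr EFin.
by rewrite !normal_pdfE// /normal_fun !subr0 sqrrN.
Qed.

Lemma ge0_integral_normal_opp s (f : measurableTypeR R -> \bar R) :
  s != 0 -> measurable_fun [set: measurableTypeR R] f ->
  (forall x, 0 <= f x)%E ->
  (\int[normal_prob 0 s]_e f (- e)%R = \int[normal_prob 0 s]_e f e)%E.
Proof.
move=> s0 mf f0.
transitivity (\int[pushforward (normal_prob 0 s)
    (-%R : _ -> measurableTypeR R)]_y f y)%E.
  by rewrite ge0_integral_pushforward.
by apply: eq_measure_integral => //= B mB _; exact/esym/normal_prob_opp.
Qed.

Let sqrD_meas a : measurable_fun [set: measurableTypeR R]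
  (fun e : R => ((a + e) ^+ 2)%:E).
Proof.
by apply/measurable_EFinP; apply: measurable_funX; exact: measurable_funD.
Qed.

Let sqr_meas : measurable_fun [set: measurableTypeR R]
  (fun e : R => (e ^+ 2)%:E).
Proof. by apply/measurable_EFinP; exact: measurable_funX. Qed.

(** The integrand is dominated by a multiple of the normal density with standard deviation [2 * s]:
    part of the exponential decay absorbs the square. *)
Lemma normal_second_moment_lty s : 0 < s ->
  (\int[normal_prob 0 s]_e ((e : R) ^+ 2)%:E < +oo)%E.
Proof.
move=> s0; have m2 := sqr_meas.
rewrite ge0_integral_normal_prob//; last by move=> x; rewrite lee_fin sqr_ge0.
(* The exponents of the two densities differ by [x = 3 * y ^+ 2 / (8 * s ^+ 2)]. The first factor of
   [C] comes from [x <= expR x], the second one exchanges the normalizations. *)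
pose C := (8 * s ^+ 2 / 3) * (normal_peak s / normal_peak (2 * s)).
have s20 : 2 * s != 0 by rewrite mulf_neq0// gt_eqF.
have C0 : 0 <= C.
  apply: mulr_ge0; apply: divr_ge0; rewrite ?normal_peak_ge0//.
  by rewrite mulr_ge0 ?sqr_ge0.
have mpdf r : measurable_fun [set: measurableTypeR R]
    (fun y => (normal_pdf 0 r y)%:E).
  by apply/measurable_EFinP; exact: measurable_normal_pdf.
apply: (@le_lt_trans _ _
    (\int[mu]_y (C%:E * (normal_pdf 0 (2 * s) y)%:E))%E); last first.
  rewrite ge0_integralZl_EFin//.
  - by rewrite integral_normal_pdf mule1 ltry.
  - by move=> y _; rewrite lee_fin normal_pdf_ge0.
apply: ge0_le_integral => //.
- by move=> y _; rewrite mule_ge0 ?lee_fin ?sqr_ge0 ?normal_pdf_ge0.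
- exact: emeasurable_funM.
- exact: measurable_funeM.
move=> y _; rewrite -!EFinM lee_fin (normal_pdfE _ s20) normal_pdfE
  ?lt0r_neq0//.
rewrite /normal_fun !subr0.
have -> : C * (normal_peak (2 * s) * expR (- y ^+ 2 / ((2 * s) ^+ 2 *+ 2))) =
    8 * s ^+ 2 / 3 * normal_peak s * expR (- y ^+ 2 / ((2 * s) ^+ 2 *+ 2)).
  by rewrite /C; field; rewrite gt_eqF// normal_peak_gt0.
pose x := 3 * y ^+ 2 / (8 * s ^+ 2).
have -> : - y ^+ 2 / ((2 * s) ^+ 2 *+ 2) = - y ^+ 2 / (s ^+ 2 *+ 2) + x.
  rewrite /x; field.
  by rewrite gt_eqF.
have -> : y ^+ 2 = 8 * s ^+ 2 / 3 * x by rewrite /x; field; rewrite gt_eqF.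
rewrite expRD.
set E := expR _; set K := 8 * _ / _; set N := normal_peak s.
have -> : K * N * (E * expR x) = K * N * E * expR x by ring.
have -> : K * x * (N * E) = K * N * E * x by ring.
have KNE0 : 0 <= K * N * E.
  rewrite mulr_ge0 ?expR_ge0// mulr_ge0 ?normal_peak_ge0//.
  by rewrite divr_ge0// mulr_ge0// sqr_ge0.
rewrite ler_wpM2l//.
by apply: le_trans (expR_ge1Dx x); rewrite lerDr.
Qed.

(** Adding the same integral with [e] replaced by [- e] cancels the cross term, so only nonnegative
    integrands occur. *)
Lemma normal_second_moment_shift s a c : 0 < s ->
  (\int[normal_prob 0 s]_e ((e : R) ^+ 2)%:E = c%:E)%E ->
  (\int[normal_prob 0 s]_e ((a + e) ^+ 2)%:E = (a ^+ 2 + c)%:E)%E.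
Proof.
move=> s0 Ec; set I := LHS.
have sq0 b (e : R) : (0 <= ((b + e) ^+ 2)%:E)%E by rewrite lee_fin sqr_ge0.
have m2 := sqr_meas.
have I2 : (I + I = (2 * a ^+ 2 + 2 * c)%:E)%E.
  rewrite -{2}/I /I -{2}(@ge0_integral_normal_opp s 
    (fun e => ((a + e) ^+ 2)%:E))
    ?gt_eqF//.
  rewrite -ge0_integralD//.
  transitivity (\int[normal_prob 0 s]_e
      ((2 * a ^+ 2)%:E + 2%:E * ((e : R) ^+ 2)%:E))%E.
    by apply: eq_integral => e _; rewrite -EFinM -!EFinD; congr EFin; ring.
  rewrite ge0_integralD//.
  - rewrite ge0_integralZl_EFin//; last by move=> e _; rewrite lee_fin sqr_ge0.
    rewrite integral_cst// [X in (_ * X)%E](probability_setT (normal_prob 0 s)).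
    by rewrite mule1 Ec -EFinM -EFinD.
  - by move=> e _; rewrite lee_fin mulr_ge0// sqr_ge0.
  - by move=> e _; rewrite -EFinM lee_fin mulr_ge0// sqr_ge0.
  - exact: measurable_funeM.
  - by apply/measurable_EFinP; apply: measurable_funX; exact: measurable_funB.
have I0 : (0 <= I)%E by exact: integral_ge0.
case: I I2 I0 => // i; rewrite -EFinD => -[ii] _; congr EFin.
lra.
Qed.

End normal_second_moment.

(** * The prediction error as loss plus a constant *)

Section prediction_error.
Context d (T : measurableType d) (R : realType) (P : probability T R).
Context (p : nat) (X : {RV P >-> p.-tuple R}) (eps : {RV P >-> R}).
Context (sigma : R).
Hypothesis sigma0 : 0 < sigma.
Hypothesis eps_normal : forall A : set R, measurable A ->
  distribution P eps A = normal_prob 0 sigma A.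
Hypothesis X_eps : independent_rv P X eps.
Implicit Types t u : p.-tuple R.

(** The constant is the second moment of the noise. As it depends on neither [t] nor [u], minimizing
    the prediction error over a model amounts to minimizing the loss. *)
Lemma prediction_errorE : exists c : R, forall t u (l : R),
  loss X t u = l%:E -> prediction_error X eps t u = (l + c)%:E.
Proof.
have := normal_second_moment_lty sigma0.
set M := (X in (X < _)%E) => Moo.
have M0 : (0 <= M)%E by apply: integral_ge0 => e _; rewrite lee_fin sqr_ge0.
have [c Mc] : exists c, M = c%:E.
  by case: M Moo M0 => // c _ _; exists c.
have c0 : 0 <= c by rewrite -lee_fin -Mc.
exists c => t u l tul; rewrite /prediction_error unlock.
pose g (z : p.-tuple R * measurableTypeR R) : \bar R :=
  ((((dot z.1 t - dot z.1 u) + z.2) ^+ 2)%R)%:E.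
have md v : measurable_fun [set: p.-tuple R * measurableTypeR R]
    (fun z => dot z.1 v).
  exact: (measurableT_comp (measurable_dot v)).
have mg : measurable_fun setT g.
  apply/measurable_EFinP; apply: measurable_funX.
  by apply: measurable_funD; [exact: measurable_funB|exact: measurable_snd].
have g0 z : (0 <= g z)%E by rewrite lee_fin sqr_ge0.
transitivity (\int[P]_w g (X w, eps w))%E.
  by apply: eq_integral => w _; rewrite /g /response /= addrAC.
rewrite (ge0_integral_joint eps_normal X_eps mg g0) /g /=.
under eq_integral do rewrite (normal_second_moment_shift _ sigma0 Mc) EFinD.
rewrite ge0_integralD//.
- rewrite -loss_distribution tul integral_cst//.
  by rewrite [X in (_ * X)%E](probability_setT (distribution P X)) mule1.
- by move=> x _; rewrite lee_fin sqr_ge0.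
- apply/measurable_EFinP; apply: measurable_funX.
  by apply: measurable_funB; exact: measurable_dot.
Qed.

End prediction_error.

(** * The loss as a quadratic form *)

Section quadratic_loss.
Context d (T : measurableType d) (R : realType) (P : probability T R).
Context (p : nat) (X : {RV P >-> p.-tuple R}) (Sigma : 'M[R]_p).
Hypothesis X0 : has_zero_mean P X.
Hypothesis XS : has_covariance P X Sigma.
Implicit Types t u : p.-tuple R.

Definition row_of_tuple t : 'rV[R]_p := \row_j tnth t j.

Lemma integral_coordM (i j : 'I_p) :
  (\int[P]_w (tnth (X w) i * tnth (X w) j)%:E = (Sigma i j)%:E)%E.
Proof.
rewrite -XS covariance.unlock !X0 expectation.unlock.
apply: eq_integral => w _ /=.
by rewrite /= !fctE /= !subr0.
Qed.

(** The product is dominated by the sum of the two squares, whose integrals are diagonal entries of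
    [Sigma]. *)
Lemma integrable_coordM (i j : 'I_p) :
  P.-integrable setT (fun w => (tnth (X w) i * tnth (X w) j)%:E).
Proof.
have mX (k : 'I_p) : measurable_fun [set: T] (fun w => tnth (X w) k).
  exact: (measurableT_comp (measurable_tnth k)).
have isq (k : 'I_p) : P.-integrable setT (fun w => (tnth (X w) k ^+ 2)%:E).
  apply/integrableP; split.
    by apply/measurable_EFinP; exact: measurable_funX.
  under eq_integral do rewrite gee0_abs ?lee_fin ?sqr_ge0// expr2.
  by rewrite integral_coordM ltry.
apply: (le_integrable measurableT _ _ 
  (integrableD measurableT (isq i) (isq j))).
  by apply/measurable_EFinP; exact: measurable_funM.
move=> w _ /=; rewrite lee_fin.
set x := tnth _ _; set y := tnth _ _.
rewrite [leRHS]ger0_norm ?addr_ge0 ?sqr_ge0// normrM.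
rewrite -(real_normK (num_real x)) -(real_normK (num_real y)).
have := sqr_ge0 (`|x| - `|y|); have := normr_ge0 x; have := normr_ge0 y.
nra.
Qed.

Lemma lossE t u : let v := row_of_tuple t - row_of_tuple u in
  loss X t u = ((v *m Sigma *m v^T) 0 0)%:E.
Proof.
move=> v; rewrite /loss unlock.
pose f i j w : \bar R :=
  ((v 0 i * v 0 j)%:E * (tnth (X w) i * tnth (X w) j)%:E)%E.
have intf i j : P.-integrable setT (f i j).
  by apply: integrableZl => //; exact: integrable_coordM.
transitivity (\int[P]_w (\sum_(i < p) \sum_(j < p) f i j w)%E)%E.
  apply: eq_integral => w _; under eq_bigr do rewrite sumEFin.
  rewrite sumEFin; congr EFin.
  have -> : dot (X w) t - dot (X w) u = \sum_(i < p) v 0 i * tnth (X w) i.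
    rewrite /dot -sumrB; apply: eq_bigr => i _.
    by rewrite /v /row_of_tuple !mxE; ring.
  rewrite expr2 mulr_suml; apply: eq_bigr => i _; rewrite mulr_sumr.
  by apply: eq_bigr => j _; rewrite mulrACA.
rewrite integral_sum//; last by move=> i; exact: integrable_sum.
transitivity (\sum_(i < p) \sum_(j < p) (v 0 i * v 0 j * Sigma i j)%:E)%E.
  apply: eq_bigr => i _; rewrite integral_sum//; apply: eq_bigr => j _.
  by rewrite integralZl ?integral_coordM//; exact: integrable_coordM.
under eq_bigr do rewrite sumEFin; rewrite sumEFin; congr EFin.
rewrite exchange_big mxE; apply: eq_bigr => j _.
rewrite !mxE mulr_suml; apply: eq_bigr => i _; ring.
Qed.

End quadratic_loss.

(** * Positive definiteness and Cholesky factorization *)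

Section cholesky.
Context {R : rcfType}.

Definition quad p (S : 'M[R]_p) (v : 'rV[R]_p) : R := (v *m S *m v^T) 0 0.

Lemma mulmx_tr_sum p (w : 'rV[R]_p) :
  (w *m w^T) 0 0 = \sum_k (w 0 k) ^+ 2.
Proof. by rewrite mxE; apply: eq_bigr => k _; rewrite mxE expr2. Qed.

(** If the form vanishes at [v], it is affine along the line through [w = v *m S] with direction
    [v], with slope twice the squared norm of [w]. Being nonnegative it has slope zero, so
    [v *m S = 0] and [v = 0]. *)
Lemma quad_unitmx_gt0 p (S : 'M[R]_p) (v : 'rV[R]_p) : S^T = S ->
  S \in unitmx -> (forall w, 0 <= quad S w) -> v != 0 -> 0 < quad S v.
Proof.
move=> ST uS q0 v0; rewrite lt_def q0 andbT; apply: contra v0 => /eqP qv.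
pose w := v *m S; pose n := \sum_k (w 0 k) ^+ 2.
have nE : (w *m w^T) 0 0 = n by exact: mulmx_tr_sum.
have quadD s : quad S (w + s *: v) = quad S w + 2 * s * n.
  have wv : w *m S *m v^T = w *m w^T by rewrite /w trmx_mul ST !mulmxA.
  have vw : v *m S *m w^T = w *m w^T by [].
  rewrite /quad linearD/= linearZ/= !mulmxDl !mulmxDr.
  rewrite -!scalemxAl -!scalemxAr wv vw.
  transitivity ((w *m S *m w^T) 0 0 + s * n + (s * n + s * (s * quad S v))).
    by rewrite -nE /quad !mxE.
  by rewrite qv; ring.
have n0 : n = 0.
  apply/eqP/negPn/negP => n0.
  (* At this point of the line the form would equal -1. *)
  have := q0 (w + (- (quad S w + 1) / (2 * n)) *: v); rewrite quadD.
  have -> : 2 * (- (quad S w + 1) / (2 * n)) * n = - (quad S w + 1) by field.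
  lra.
have w0 : w = 0.
  apply/rowP => k; rewrite [RHS]mxE; apply/eqP; rewrite -sqrf_eq0.
  move/eqP: n0; rewrite psumr_eq0; last by move=> j _; exact: sqr_ge0.
  by move=> /allP/(_ k); rewrite mem_index_enum => /(_ isT)/implyP; exact.
by rewrite -[v](mulmxK uS) -/w w0 mul0mx.
Qed.

(** Induction through the Schur complement of the top left entry. The inverse [L] is built along
    with [M], which shows that it is lower triangular too. *)
Lemma cholesky p (S : 'M[R]_p) : S^T = S ->
  (forall v, v != 0 -> 0 < quad S v) ->
  exists M L : 'M[R]_p,
    [/\ is_trig_mx M, is_trig_mx L, M *m L = 1%:M & S = M *m M^T].
Proof.
elim: p S => [|p IH] S ST Spos.
  exists 0, 0; split; try by rewrite [LHS]flatmx0 [RHS]flatmx0.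
  - by apply/is_trig_mxP => -[].
  - by apply/is_trig_mxP => -[].
rewrite -[p.+1]/(1 + p)%N in S ST Spos *.
pose c := S 0 0; pose b : 'cV_p := dlsubmx S; pose D := drsubmx S.
have SE : S = block_mx c%:M b^T b D.
  rewrite -{1}[S]submxK; congr block_mx.
    apply/matrixP => i j; rewrite !mxE !ord1 /= mulr1n.
    by congr (S _ _); exact: val_inj.
  by rewrite /b trmx_dlsub ST.
have quadE (x : 'M[R]_1) (y : 'rV[R]_p) : quad S (row_mx x y) =
    c * x 0 0 ^+ 2 + 2 * x 0 0 * (y *m b) 0 0 + quad D y.
  have xby : (x *m b^T *m y^T) 0 0 = (y *m b) 0 0 * x 0 0.
    rewrite -mulmxA -trmx_mul [x]mx11_scalar mul_scalar_mx !mxE eqxx mulr1n.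
    by rewrite mulrC.
  have ybx : (y *m b *m x^T) 0 0 = (y *m b) 0 0 * x 0 0.
    by rewrite mxE big_ord1 [x^T _ _]mxE.
  have xcx : (x *m c%:M *m x^T) 0 0 = c * x 0 0 ^+ 2.
    rewrite mul_mx_scalar -scalemxAl [LHS]mxE mxE big_ord1 [x^T _ _]mxE.
    by rewrite expr2.
  rewrite /quad SE mul_row_block tr_row_mx mul_row_col !mulmxDl.
  transitivity ((x *m c%:M *m x^T) 0 0 + (y *m b *m x^T) 0 0 +
    ((x *m b^T *m y^T) 0 0 + (y *m D *m y^T) 0 0)); first by rewrite !mxE.
  by rewrite xcx ybx xby; ring.
have c0 : 0 < c.
  have := Spos (row_mx 1 0); rewrite quadE mul0mx /quad !mul0mx !mxE/=.
  rewrite expr1n !mulr1 mulr0 !addr0; apply; apply/eqP.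
  move=> /(congr1 (fun z : 'rV[R]_(1 + p) => z 0 (lshift p 0))).
  by rewrite row_mxEl !mxE /= => /eqP; rewrite oner_eq0.
(* The Schur complement of [c] in [S]. *)
pose S' := D - c^-1 *: (b *m b^T).
have DT : D^T = D by rewrite /D trmx_drsub ST.
have S'T : S'^T = S'.
  by rewrite /S' linearB /= linearZ /= trmx_mul trmxK DT.
have S'pos v : v != 0 -> 0 < quad S' v.
  (* This first entry minimizes the form of [S] over all extensions of [v]; the minimum is
     [quad S' v]. *)
  move=> v0; have := Spos (row_mx (- c^-1 *: (v *m b)) v).
  rewrite quadE; set z := (v *m b) 0 0.
  have -> : (- c^-1 *: (v *m b)) 0 0 = - c^-1 * z by rewrite mxE.
  have -> : quad S' v = quad D v - c^-1 * z ^+ 2.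
    rewrite /quad /S' mulmxBr mulmxBl -scalemxAr -scalemxAl.
    transitivity ((v *m D *m v^T) 0 0 - c^-1 * (v *m (b *m b^T) *m v^T) 0 0).
      by rewrite !mxE.
    congr (_ - _ * _); rewrite mulmxA -mulmxA -trmx_mul mxE big_ord1.
    by rewrite [_^T _ _]mxE expr2.
  have -> : c * (- c^-1 * z) ^+ 2 + 2 * (- c^-1 * z) * z + quad D v =
      quad D v - c^-1 * z ^+ 2 by field; rewrite gt_eqF.
  apply; apply: contra v0 => /eqP/(congr1 rsubmx); rewrite row_mxKr => ->.
  by rewrite linear0.
have [M' [L' [tM' tL' ML' S'E]]] := IH _ S'T S'pos.
pose r := Num.sqrt c.
have r0 : r != 0 by rewrite gt_eqF// sqrtr_gt0.
have r2 : r * r = c by rewrite -expr2 sqr_sqrtr// ltW.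
exists (block_mx r%:M 0 (r^-1 *: b) M').
(* The lower left block is forced by the vanishing of the same block of [M *m L]. *)
exists (block_mx (r^-1)%:M 0 (- (c^-1) *: (L' *m b)) L').
split.
- by rewrite is_trig_block_mx// eqxx scalar_mx_is_trig.
- by rewrite is_trig_block_mx// eqxx scalar_mx_is_trig.
- rewrite mulmx_block !mul0mx !mulmx0 !addr0 !add0r ML' -scalar_mxM divff//.
  rewrite -scalemxAr mulmxA ML' mul1mx mul_mx_scalar scalerA -scalerDl.
  by rewrite -invfM r2 subrr scale0r -scalar_mx_block.
- rewrite SE tr_block_mx !trmx0 mulmx_block !mul0mx !mulmx0 !addr0.
  rewrite !tr_scalar_mx -scalar_mxM r2 !linearZ /=.
  rewrite !mul_scalar_mx !mul_mx_scalar.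
  rewrite !scalerA mulVf// !scale1r -S'E /S' -scalemxAl scalerA.
  by rewrite -invfM r2 addrC subrK divff// scale1r.
Qed.

End cholesky.

(** * Best approximations and the ellipsoid in Cholesky coordinates *)

Section ellipsoid.
Context d (T : measurableType d) (R : realType) (P : probability T R).
Context (p : nat) (X : {RV P >-> p.-tuple R}) (eps : {RV P >-> R}).
Context (M L : 'M[R]_p).
Implicit Types (t u : p.-tuple R) (v : 'rV[R]_p).

Definition coords t : 'rV[R]_p := row_of_tuple t *m M.

Definition tuple_of_coords v : p.-tuple R := [tuple (v *m L) 0 j | j < p].

Hypothesis loss_coords : forall t u,
  loss X t u = (\sum_k (coords t 0 k - coords u 0 k) ^+ 2)%:E.
Hypothesis prediction_errorE : exists c : R, forall t u (l : R),
  loss X t u = l%:E -> prediction_error X eps t u = (l + c)%:E.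
Hypothesis trigM : is_trig_mx M.
Hypothesis trigL : is_trig_mx L.
Hypothesis ML : M *m L = 1%:M.

Lemma row_of_tuple_of_coords v : row_of_tuple (tuple_of_coords v) = v *m L.
Proof. by apply/rowP => j; rewrite mxE tnth_mktuple. Qed.

Lemma tuple_of_coordsK v : coords (tuple_of_coords v) = v.
Proof.
by rewrite /coords row_of_tuple_of_coords -mulmxA (mulmx1C ML) mulmx1.
Qed.

(** Entry [k] of [v *m A] involves only the entries of [v] of index at least [k]. Applied to [M] and
    to [L], this shows that the models are the same in both coordinate systems. *)
Lemma trig_mulmx_eq0 (A : 'M[R]_p) v (i : nat) : is_trig_mx A ->
  (forall k : 'I_p, (i <= k)%N -> v 0 k = 0) ->
  forall k : 'I_p, (i <= k)%N -> (v *m A) 0 k = 0.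
Proof.
move=> /is_trig_mxP tA v0 k ik; rewrite mxE big1// => j _.
have [jk|kj] := ltnP j k; first by rewrite tA// mulr0.
by rewrite v0 ?mul0r// (leq_trans ik).
Qed.

Lemma in_model_coords (i : nat) t : in_model i t ->
  forall k : 'I_p, (i <= k)%N -> coords t 0 k = 0.
Proof.
by move=> it; apply: trig_mulmx_eq0 => // k ik; rewrite mxE; exact: it.
Qed.

Lemma in_model_tuple_of_coords (i : nat) v :
  (forall k : 'I_p, (i <= k)%N -> v 0 k = 0) -> in_model i (tuple_of_coords v).
Proof.
by move=> v0 k ik; rewrite tnth_mktuple; exact: trig_mulmx_eq0 ik.
Qed.

Definition trunc (i : nat) v : 'rV[R]_p :=
  \row_k (if (k < i)%N then v 0 k else 0).

Lemma truncE (i : nat) v k : trunc i v 0 k = if (k < i)%N then v 0 k else 0.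
Proof. exact: mxE. Qed.

(** On the model the loss splits into [near u] and a part [far] that does not depend on [u]. The
    truncation makes [near] vanish, so every minimizer does, and this fixes its coordinates. *)
Lemma coords_best_approximation (i : nat) t :
  coords (best_approximation X eps i t) = trunc i (coords t).
Proof.
pose b := tuple_of_coords (trunc i (coords t)).
have bm : in_model i b.
  by apply: in_model_tuple_of_coords => k ik; rewrite mxE ltnNge ik.
have [c peE] := prediction_errorE.
pose far : R := \sum_(k < p | ~~ (k < i)%N) coords t 0 k ^+ 2.
pose near u : R := \sum_(k < p | (k < i)%N) (coords t 0 k - coords u 0 k) ^+ 2.
have lossi u : in_model i u -> loss X t u = (near u + far)%:E.
  move=> iu; rewrite loss_coords (bigID (fun k : 'I_p => (k < i)%N)) /=.
  congr (_ + _)%:E; apply: eq_bigr => k; rewrite -leqNgt => ik.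
  by rewrite (in_model_coords iu) ?subr0.
have near_ge0 u : 0 <= near u by apply: sumr_ge0 => k _; exact: sqr_ge0.
have nearb : near b = 0.
  by apply: big1 => k ki; rewrite tuple_of_coordsK truncE ki subrr expr0n.
have bb : best_approximations X eps i t b.
  split => // v iv; rewrite (peE _ _ _ (lossi _ bm)) (peE _ _ _ (lossi _ iv)).
  by rewrite lee_fin nearb add0r lerD2r lerDr.
(* As [b] is a minimizer, [xget] returns a minimizer and not its default value. *)
have [um umin] : best_approximations X eps i t (best_approximation X eps i t).
  by apply: xgetPex; exists b.
set u := best_approximation _ _ _ _ in um umin *.
have := umin _ bm; rewrite (peE _ _ _ (lossi _ bm)) (peE _ _ _ (lossi _ um)).
rewrite lee_fin nearb add0r lerD2r gerDr => near0.
have /eqP : near u = 0 by apply/eqP; rewrite eq_le near0 near_ge0.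
rewrite psumr_eq0; last by move=> k _; exact: sqr_ge0.
move=> /allP h; apply/rowP => k; rewrite truncE; case: ifPn => ki.
  have := h k (mem_index_enum _); rewrite /= ki /= sqrf_eq0 subr_eq0.
  by move=> /eqP.
by rewrite (in_model_coords um)// leqNgt.
Qed.

(** The two truncations differ in one entry only. Since [i] counts from 0, this is the numerator of
    the term of index [i.+1] in the ellipsoid. *)
Lemma loss_best_approximation (i : 'I_p) t :
  loss X (best_approximation X eps i t) (best_approximation X eps i.+1 t)
  = (coords t 0 i ^+ 2)%:E.
Proof.
rewrite loss_coords !coords_best_approximation (bigD1 i)//= big1; last first.
  move=> k; rewrite -(inj_eq val_inj) => /negbTE ki.
  by rewrite !truncE ltnS [(k <= i)%N]leq_eqVlt [(_ == _)%N]ki /= subrr expr0n.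
by rewrite !truncE ltnn ltnSn sub0r sqrrN addr0.
Qed.

Lemma mem_ellipsoid (a : nat -> R) (r D : R) (i : nat) t :
  (0 < i <= p)%N -> 0 <= a i ->
  (forall j k : nat, (1 <= j)%N -> (j <= k)%N -> (k <= p.+1)%N -> a k <= a j) ->
  i%:R * D <= a i ^+ 2 * r ^+ 2 ->
  (forall k : 'I_p, coords t 0 k ^+ 2 <= D) ->
  (forall k : 'I_p, (i <= k)%N -> coords t 0 k = 0) ->
  ellipsoid X eps a r t.
Proof.
move=> /andP[i0 ip] ai0 a_dec iD tD t0.
have i0' : (0 : R) < i%:R by rewrite ltr0n.
rewrite /ellipsoid/=.
(* The budget [r ^+ 2] is shared equally among the first [i] terms; each fits its share because [a]
   is non increasing. *)
apply: (@le_trans _ _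
  (\sum_(1 <= j < p.+1 | (j < i.+1)%N) (r ^+ 2 / i%:R)%:E)%E); last first.
  rewrite -(@big_nat_widen _ _ _ 1 i.+1 p.+1 xpredT)//.
  rewrite sumEFin lee_fin sumr_const_nat subSS subn0.
  by rewrite -[leLHS]mulr_natr divfK// gt_eqF.
rewrite [leRHS]big_mkcond/= big_seq [leRHS]big_seq.
apply: lee_sum => j; rewrite mem_index_iota => /andP[j0 jp].
have jp' : (j.-1 < p)%N by rewrite prednK.
have := loss_best_approximation (Ordinal jp') t; rewrite /= prednK// => ->.
(* Beyond [i] the numerator is 0, and so is the term, even where [a j = 0]. *)
case: ifPn => ji; last first.
  rewrite t0 ?expr0n ?mul0e//=.
  by rewrite -ltnS prednK// ltnNge -ltnS.
have aj0 : 0 <= a j.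
  by apply: le_trans ai0 _; apply: a_dec => //; rewrite leqW.
have uaj : coords t 0 (Ordinal jp') ^+ 2 * i%:R <= a j ^+ 2 * r ^+ 2.
  rewrite mulrC; apply: le_trans (le_trans iD _); first by rewrite ler_wpM2l.
  rewrite ler_wpM2r ?sqr_ge0// ler_sqr ?nnegrE//.
  by apply: a_dec => //; rewrite leqW.
have [aj|aj] := eqVneq (a j) 0.
  have -> : coords t 0 (Ordinal jp') ^+ 2 = 0.
    apply/eqP; rewrite eq_le sqr_ge0 andbT -(pmulr_lle0 _ i0').
    by rewrite (le_trans uaj)// aj expr0n mul0r.
  by rewrite mul0e lee_fin divr_ge0 ?sqr_ge0.
have aj2 : 0 < a j ^+ 2 by rewrite exprn_even_gt0.
rewrite inver gt_eqF//= -EFinM lee_fin ler_pdivlMr// mulrAC.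
by rewrite ler_pdivrMr// [r ^+ 2 * _]mulrC.
Qed.

End ellipsoid.

(** * Two elementary inequalities *)

Lemma bernoulli_ineq (R : realType) (x : R) n : 0 <= x <= 1 ->
  1 - n%:R * x <= (1 - x) ^+ n.
Proof.
move=> /andP[x0 x1]; elim: n => [|n IH]; first by rewrite mul0r subr0 expr0.
rewrite exprS; apply: (@le_trans _ _ ((1 - x) * (1 - n%:R * x))); last first.
  by rewrite ler_wpM2l ?subr_ge0.
have : 0 <= n%:R * x * x by rewrite !mulr_ge0.
by rewrite -natr1; nra.
Qed.

(** Arithmetic-geometric mean inequality, with [A * B = x ^+ 4 + 4 * s ^+ 4]. The [s ^+ 2] added to
    both squares keeps this product away from 0; without it the product would vanish at [x = s] and
    [x = - s]. *)
Lemma two_point_convexity (R : realType) (x s l : R) : 0 < l ->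
  4 * s ^+ 2 <= l * ((x - s) ^+ 2 + s ^+ 2) + l^-1 * ((x + s) ^+ 2 + s ^+ 2).
Proof.
move=> l0; set A := (x - s) ^+ 2 + _; set B := (x + s) ^+ 2 + _.
have A0 : 0 <= A by rewrite addr_ge0 ?sqr_ge0.
have B0 : 0 <= B by rewrite addr_ge0 ?sqr_ge0.
have AB : 4 * s ^+ 4 <= A * B.
  have -> : A * B = x ^+ 4 + 4 * s ^+ 4 by rewrite /A /B; ring.
  by rewrite lerDr exprn_even_ge0.
have [A00|A00] := eqVneq A 0.
  have -> : s ^+ 2 = 0.
    by apply/eqP; move/eqP: A00; rewrite paddr_eq0 ?sqr_ge0// => /andP[].
  by rewrite mulr0 addr_ge0// mulr_ge0// ?invr_ge0 ltW.
have Ap : 0 < A by rewrite lt_def A00.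
rewrite -subr_ge0 -(pmulr_rge0 _ l0) -(pmulr_rge0 _ Ap).
have -> : A * (l * (l * A + l^-1 * B - 4 * s ^+ 2)) =
    (l * A - 2 * s ^+ 2) ^+ 2 + (A * B - 4 * s ^+ 4).
  by field; rewrite gt_eqF.
by rewrite addr_ge0 ?sqr_ge0// subr_ge0.
Qed.

(** * Assouad's argument on the cube of signs *)

Section assouad.
Context d (T : measurableType d) (R : realType) (P : probability T R).
Context (p : nat) (X : {RV P >-> p.-tuple R}) (eps : {RV P >-> R}).
Context (M L : 'M[R]_p) (sigma : R) (n : nat).
Hypothesis sigma0 : 0 < sigma.
Hypothesis eps_normal : forall A : set R, measurable A ->
  distribution P eps A = normal_prob 0 sigma A.
Hypothesis X_eps : independent_rv P X eps.
Hypothesis loss_coords : forall t u,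
  loss X t u = (\sum_k (coords M t 0 k - coords M u 0 k) ^+ 2)%:E.
Hypothesis ML : M *m L = 1%:M.
Hypothesis n0 : (0 < n)%N.
Variables (i : nat) (s : R).
Hypothesis ip : (i <= p)%N.
Hypothesis s_small : s ^+ 2 <= sigma ^+ 2 / (2 * n%:R).
Variable that : {mfun n.-tuple (R * p.-tuple R)%type >-> p.-tuple R}.

(** Signs are attached to all [p] coordinates while [cube] reads the first [i]: every vertex is
    counted equally often, so averages over [W] are averages over the cube. *)
Let W : finType := {ffun 'I_p -> bool}.
Implicit Type w : W.

Definition cube w : 'rV[R]_p :=
  \row_k (if (k < i)%N then if w k then s else - s else 0).

Let theta w : p.-tuple R := tuple_of_coords L (cube w).

Definition flip (k : 'I_p) w : W := [ffun j => if j == k then ~~ w j else w j].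

Lemma flipK k : involutive (flip k).
Proof.
by move=> w; apply/ffunP => j; rewrite !ffunE; case: eqP => // _; rewrite negbK.
Qed.

Lemma cube_flip (k j : 'I_p) w : (k < i)%N ->
  cube (flip k w) 0 j = if j == k then - cube w 0 j else cube w 0 j.
Proof.
move=> ki; rewrite !mxE ffunE; case: eqP => [->|//]; rewrite ki.
by case: (w k) => /=; rewrite ?opprK.
Qed.

Lemma cube_sqr (k : 'I_p) w : (k < i)%N -> cube w 0 k ^+ 2 = s ^+ 2.
Proof. by move=> ki; rewrite mxE ki; case: ifP; rewrite ?sqrrN. Qed.

Let hat z k : R := coords M (that z) 0 k.

Lemma measurable_hat k : measurable_fun setT (fun z => hat z k).
Proof.
rewrite /hat /coords; under eq_fun do rewrite mxE.
apply: measurable_sum => j; apply: measurable_funM => //.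
under eq_fun do rewrite mxE.
exact: (measurableT_comp (measurable_tnth j)).
Qed.

Let risk1 w k : \bar R :=
  (\int[sample_law X eps n (theta w)]_z ((hat z k - cube w 0 k) ^+ 2)%:E)%E.

Let measurable_sq k (c : R) :
  measurable_fun setT (fun z => ((hat z k - c) ^+ 2)%:E).
Proof.
apply/measurable_EFinP; apply: measurable_funX.
by apply: measurable_funB => //; exact: measurable_hat.
Qed.

Lemma risk_sum w : risk X eps that (theta w) = (\sum_k risk1 w k)%E.
Proof.
rewrite /risk /risk1 -ge0_integral_sum//; last first.
  by move=> k z _; rewrite lee_fin sqr_ge0.
apply: eq_integral => z _; rewrite loss_coords sumEFin; congr EFin.
by apply: eq_bigr => k _; rewrite tuple_of_coordsK.
Qed.

(** What one observation loses in affinity between neighbouring vertices, which are at loss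
    [(2 * s) ^+ 2]. The bound [s_small] is what makes [n%:R * x <= 4^-1]. *)
Let x : R := (2 * s) ^+ 2 / (8 * sigma ^+ 2).

Let x0 : 0 <= x.
Proof. by rewrite divr_ge0 ?sqr_ge0// mulr_ge0 ?sqr_ge0. Qed.

Let nx : n%:R * x <= 4^-1.
Proof.
have n0' : (0 : R) < n%:R by rewrite ltr0n.
rewrite /x mulrA ler_pdivrMr ?mulr_gt0 ?exprn_gt0//.
move: s_small; rewrite ler_pdivlMr ?mulr_gt0//; nra.
Qed.

Let x1 : x <= 1.
Proof.
have : (1 : R) <= n%:R by rewrite ler1n.
by move: nx x0; nra.
Qed.

Lemma affinity_ge_flip w (k : 'I_p) : (k < i)%N ->
  affinity_ge (sample_law X eps n (theta w))
    (sample_law X eps n (theta (flip k w)))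
    ((1 - x) ^+ n).
Proof.
move=> ki; apply: affinity_ge_iid.
  by rewrite subr_ge0.
apply: affinity_ge_observation => //.
rewrite loss_coords (bigD1 k)//= big1 ?addr0; last first.
  move=> j jk; rewrite !tuple_of_coordsK// cube_flip//.
  by rewrite (negbTE jk) subrr expr0n.
rewrite !tuple_of_coordsK// cube_flip// eqxx opprK exprMn -(cube_sqr w ki).
by congr EFin; ring.
Qed.

(** The affinity bound, at weight 1, is applied to the squared errors increased by [s ^+ 2]. The
    affinity is at least 3/4 by Bernoulli, so the two risks plus [2 * s ^+ 2] are at least
    [3 / 4 * (4 * s ^+ 2)]. *)
Lemma two_point_risk w (k : 'I_p) : (k < i)%N ->
  ((s ^+ 2)%:E <= risk1 w k + risk1 (flip k w) k)%E.
Proof.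
move=> ki; set c := cube w 0 k.
have c2 : c ^+ 2 = s ^+ 2 by exact: cube_sqr.
pose f (b : R) z : \bar R := (((hat z k - b) ^+ 2)%:E + (s ^+ 2)%:E)%E.
have mf b : measurable_fun setT (f b) by exact: emeasurable_funD.
have f0 b z : (0 <= f b z)%E by rewrite lee_fin addr_ge0 ?sqr_ge0.
have intf w' : (\int[sample_law X eps n (theta w')]_z f (cube w' 0%R k) z =
    risk1 w' k + (s ^+ 2)%:E)%E.
  rewrite ge0_integralD//.
  - rewrite integral_cst//.
    rewrite [X in (_ + _ * X)%E](probability_setT (sample_law _ _ _ _)).
    by rewrite mule1.
  - by move=> z _; rewrite lee_fin sqr_ge0.
  - by move=> z _; rewrite lee_fin sqr_ge0.
have fg z (l : R) : 0 < l ->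
    ((4 * s ^+ 2)%:E <= l%:E * f c z + l^-1%:E * f (cube (flip k w) 0%R k) z)%E.
  move=> l0; rewrite /f cube_flip// eqxx -!EFinD lee_fin -c2 opprK.
  exact: two_point_convexity.
have k0 : 0 <= 4 * s ^+ 2 by rewrite mulr_ge0 ?sqr_ge0.
have := affinity_ge_flip w ki (mf c) (mf (cube (flip k w) 0 k)) (f0 _) (f0 _) k0
  fg ltr01.
rewrite (intf w) (intf (flip k w)) mul1e invr1.
rewrite mul1e addeACA -EFinD -leeBlDr// => h.
apply: le_trans h; rewrite -EFinB lee_fin.
have x01 : 0 <= x <= 1 by rewrite x0 x1.
have := bernoulli_ineq n x01; have := nx.
set q := (1 - x) ^+ n; set y := n%:R * x => hy hq.
have : 3 / 4 <= q by lra.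
have := sqr_ge0 s; nra.
Qed.

Lemma assouad_cube (B : \bar R) :
  (forall w, risk X eps that (theta w) <= B)%E ->
  ((i%:R * s ^+ 2 / 2)%:E <= B)%E.
Proof.
move=> riskB; have r0 w k : (0 <= risk1 w k)%E.
  by apply: integral_ge0 => z _; rewrite lee_fin sqr_ge0.
have B0 : (0 <= B)%E.
  apply: le_trans (riskB [ffun=> true]); rewrite risk_sum.
  by apply: sume_ge0 => k _; exact: r0.
case: B riskB B0 => [b riskB _| |]//; last by move=> _ _; exact: leey.
pose N : R := #|W|%:R.
have N0 : 0 < N by rewrite ltr0n; apply/card_gt0P; exists [ffun=> true].
pose S k := (\sum_w risk1 w k)%E.
have SN (k : 'I_p) : (k < i)%N -> ((N * s ^+ 2)%:E <= S k + S k)%E.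
  (* Flipping permutes the cube, so one copy of [S k] can be summed over flipped vertices and each
     [w] paired with its neighbour. *)
  move=> ki; rewrite {2}/S (reindex_inj (inv_inj (flipK k))) -big_split /=.
  apply: le_trans (lee_sum _ (fun w _ => two_point_risk w ki)).
  by rewrite sumEFin sumr_const lee_fin mulr_natl.
have sumS : (\sum_(k < p) S k <= (N * b)%:E)%E.
  rewrite exchange_big /=; apply: (@le_trans _ _ (\sum_(w : W) b%:E)%E).
    by apply: lee_sum => w _; rewrite -risk_sum.
  by rewrite sumEFin sumr_const lee_fin mulr_natl.
have S0 k : (0 <= S k)%E by apply: sume_ge0.
have sumSi : (\sum_(k < p | (k < i)%N) S k <= (N * b)%:E)%E.
  apply: le_trans sumS; rewrite [leRHS](bigID (fun k : 'I_p => (k < i)%N)) /=.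
  by rewrite leeDl// sume_ge0.
have : (\sum_(k < p | (k < i)%N) (N * s ^+ 2)%:E <= (N * b)%:E + (N * b)%:E)%E.
  apply: le_trans (leeD sumSi sumSi); rewrite -big_split /=.
  exact: lee_sum.
have -> : (\sum_(k < p | (k < i)%N) (N * s ^+ 2)%:E =
    (i%:R * (N * s ^+ 2))%:E)%E.
  rewrite -(big_mkord (fun k => (k < i)%N) (fun=> (N * s ^+ 2)%:E)).
  rewrite -(big_nat_widen 0 i p xpredT)// sumEFin sumr_const_nat subn0.
  by rewrite mulr_natl.
rewrite -EFinD !lee_fin => h.
rewrite ler_pdivrMr// -(ler_pM2l N0); lra.
Qed.

End assouad.

(** * The lower bound: choice of the cube and of the constant *)

Theorem proposition4p1 (R : realType) :
  exists2 L : R, 0 < L &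
    forall (n p : nat) (Sigma : 'M[R]_p) (sigma : R)
      (d : measure_display) (T : measurableType d) (P : probability T R)
      (X : {RV P >-> p.-tuple R}) (eps : {RV P >-> R})
      (a : nat -> R) (r : R),
    (0 < n)%N ->
    gaussian_vector P X -> has_zero_mean P X -> has_covariance P X Sigma ->
    Sigma \in unitmx ->
    0 < sigma ->
    (forall A : set R, measurable A ->
      distribution P eps A = normal_prob 0 sigma A) ->
    independent_rv P X eps ->
    (forall i j : nat, (1 <= i)%N -> (i <= j)%N -> (j <= p.+1)%N ->
      a j <= a i) ->
    a 1%N = 1 -> a p.+1 = 0 ->
    0 < r ->
    (L%:E * ereal_sup [set (Num.min (a i ^+ 2 * r ^+ 2)
                                    (sigma ^+ 2 * i%:R / n%:R))%:E
                      | i in [set i : nat | (1 <= i <= p)%N]]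
     <= minimax_risk X eps n (ellipsoid X eps a r))%E.
Proof.
(* The cube yields [i%:R * D / 2], the minimum of [a i ^+ 2 * r ^+ 2 / 2] and
   [sigma ^+ 2 * i%:R / (4 * n%:R)]; the second term dictates 1/4. *)
exists 4^-1; first by rewrite invr_gt0.
move=> n p Sigma sigma d T P X eps a r n0 _ X0 XS uS sigma0 eN Xe a_dec _ ap _.
have ST : Sigma^T = Sigma.
  apply/matrixP => i j; rewrite mxE; apply: EFin_inj.
  by rewrite -XS covarianceC XS.
have q0 w : 0 <= quad Sigma w.
  rewrite -lee_fin.
  (* The form is nonnegative because its values are losses; the identity matrix merely turns rows
     into tuples. *)
  have := lossE X0 XS (tuple_of_coords 1%:M w) (tuple_of_coords 1%:M 0).
  rewrite /= !row_of_tuple_of_coords !mulmx1 subr0 => <-.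
  rewrite loss_distribution; apply: integral_ge0 => x _.
  by rewrite lee_fin sqr_ge0.
have [M [L [tM tL ML SM]]] :=
  cholesky ST (fun v => quad_unitmx_gt0 ST uS q0 (v := v)).
have loss_coords t u :
    loss X t u = (\sum_k (coords M t 0 k - coords M u 0 k) ^+ 2)%:E.
  rewrite (lossE X0 XS) SM; congr EFin; set v := _ - _.
  rewrite mulmxA -mulmxA -trmx_mul mulmx_tr_sum; apply: eq_bigr => k _.
  by rewrite /v mulmxBl mxE [X in _ + X]mxE.
have pE := prediction_errorE sigma0 eN Xe.
rewrite muleC -lee_pdivlMr//; apply: ge_ereal_sup => _ [i /andP[i0 ip] <-].
rewrite lee_pdivlMr//.
apply: le_ereal_inf_tmp => _ [that _ <-].
have i0' : (0 : R) < i%:R by rewrite ltr0n.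
have n0' : (0 : R) < n%:R by rewrite ltr0n.
have ai0 : 0 <= a i by rewrite -ap a_dec// leqW.
(* The largest [s ^+ 2] allowed by both constraints: the cube lies in the ellipsoid, and
   neighbouring vertices are hard to tell apart from [n] observations. *)
pose D := Num.min (a i ^+ 2 * r ^+ 2 / i%:R) (sigma ^+ 2 / (2 * n%:R)).
have D0 : 0 <= D.
  rewrite le_min; apply/andP.
  split; apply: divr_ge0; rewrite ?sqr_ge0 ?ler0n//.
  by rewrite mulr_ge0 ?sqr_ge0.
pose s := Num.sqrt D.
have s2 : s ^+ 2 = D by rewrite sqr_sqrtr.
have sD : s ^+ 2 <= sigma ^+ 2 / (2 * n%:R) by rewrite s2 ge_min lexx orbT.
have iD : i%:R * D <= a i ^+ 2 * r ^+ 2.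
  by rewrite mulrC -ler_pdivlMr// ge_min lexx.
apply: le_trans
  (assouad_cube sigma0 eN Xe loss_coords ML n0 ip sD (that := that) _).
  rewrite s2 -EFinM lee_fin.
  set m := Num.min _ _; have mA : m <= a i ^+ 2 * r ^+ 2 by rewrite ge_min lexx.
  have mB : m <= sigma ^+ 2 * i%:R / n%:R by rewrite ge_min lexx orbT.
  have A0 : 0 <= a i ^+ 2 * r ^+ 2 by rewrite mulr_ge0 ?sqr_ge0.
  have [->|->] : D = a i ^+ 2 * r ^+ 2 / i%:R \/ D = sigma ^+ 2 / (2 * n%:R).
  - by rewrite /D minEle; case: ifP; [left|right].
  - by rewrite mulrCA divff ?mulr1 ?gt_eqF//; lra.
  have -> : i%:R * (sigma ^+ 2 / (2 * n%:R)) / 2 = sigma ^+ 2 * i%:R / n%:R / 4.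
    by field; rewrite gt_eqF.
  lra.
move=> w; apply: ereal_sup_ubound.
exists (tuple_of_coords L (cube i s w)) => //.
apply: (mem_ellipsoid loss_coords pE tM tL ML (i := i) (D := D)) => //.
- by rewrite i0.
- move=> k; rewrite tuple_of_coordsK//.
  rewrite mxE; case: ifP => _; last by rewrite expr0n.
  by case: ifP => _; rewrite ?sqrrN s2.
- by move=> k ik; rewrite tuple_of_coordsK// mxE ltnNge ik.
Qed.
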